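(* Let $\mathcal{X}$ be a subset of a Euclidean space $\mathcal{E}$. (1) Let $x\in\mathcal{X}$, let $(x_k)_{k\geq1}\subseteq\mathcal{X}$ be a sequence converging to $x$, and let $f$ be a continuously differentiable real-valued function defined on a neighborhood of $\mathcal{X}$ in $\mathcal{E}$. The triplet $(x,(x_k)_{k\geq 1},f)$ is an apocalypse on $\mathcal{X}$ if and only if $-\nabla f(x)\in\left(\limsup_k\mathrm{T}_{x_k}\mathcal{X}\right)^{\circ}\setminus(\mathrm{T}_x\mathcal{X})^{\circ}$. (2) A point $x\in\mathcal{X}$ is apocalyptic if and only if there exists a sequence $(x_k)_{k\geq 1}\subseteq\mathcal{X}$ converging to $x$ such that $\left(\limsup_k\mathrm{T}_{x_k}\mathcal{X}\right)^{\circ}\not\subseteq(\mathrm{T}_x\mathcal{X})^{\circ}$, or equivalently, such that $\mathrm{T}_x\mathcal{X}\not\subseteq\overline{\mathrm{conv}}\left(\limsup_k\mathrm{T}_{x_k}\mathcal{X}\right)$.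
   Context: Tangent cone: $\mathrm{T}_x\mathcal{X}=\{v=\lim_{k\to\infty}(z_k-x)/\tau_k : z_k\in\mathcal{X},\ \tau_k>0,\ \tau_k\to 0,\text{ the limit exists}\}$, a closed cone (not necessarily convex). Polar of a cone $K\subseteq\mathcal{E}$: $K^\circ=\{w\in\mathcal{E}:\langle w,v\rangle\leq 0\ \forall v\in K\}$. $\overline{\mathrm{conv}}(A)$ is the closure of the convex hull of $A$. Outer limit of subsets $C_k\subseteq\mathcal{E}$: $\limsup_k C_k=\{v\in\mathcal{E}:\liminf_{k\to\infty}\operatorname{dist}(v,C_k)=0\}$. $\operatorname{Proj}_K(v)$ denotes any closest point to $v$ in the closed cone $K$ (all such points have the same norm). A point $x\in\mathcal{X}$ is stationary for $\min_{\mathcal{X}}f$ if $\mathrm{D}f(x)[v]\geq 0$ for all $v\in\mathrm{T}_x\mathcal{X}$; it is $\epsilon$-stationary if $\|\operatorname{Proj}_{\mathrm{T}_x\mathcal{X}}(-\nabla f(x))\|\leq\epsilon$. A triplet $(x,(x_k)_{k\geq1},f)$, with $(x_k)\subseteq\mathcal{X}$ converging to $x\in\mathcal{X}$ and $f$ continuously differentiable, is an apocalypse if the $x_k$ are $\epsilon_k$-stationary for $\min_{\mathcal{X}}f$ for some sequence $\epsilon_k>0$ converging to $0$, but $x$ is not stationary. A point $x\in\mathcal{X}$ is apocalyptic if it belongs to some apocalypse $(x,(x_k)_{k\geq1},f)$. *)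

(* Defs.v *)
From HB Require Import structures.
From mathcomp Require Import all_boot all_order all_algebra.
From mathcomp Require Import all_classical all_reals all_analysis.

Set Implicit Arguments.
Unset Strict Implicit.
Unset Printing Implicit Defensive.

Import Order.TTheory GRing.Theory Num.Theory.
Import numFieldNormedType.Exports.

Local Open Scope classical_set_scope.
Local Open Scope ring_scope.

(* Euclidean space: finite dimension comes from Vector, and the norm (hence
   the topology) is the one induced by the inner product. *)
HB.mixin Record NormedModule_isEuclidean (R : realType) E
    & NormedModule R E := {
  dotp : {dot E for (@idfun R)} ;
  norm_dotp : forall v : E, `|v| ^+ 2 = dotp v v
}.

#[short(type="euclideanType")]
HB.structure Definition Euclidean (R : realType) :=
  {E of NormedModule R E & Vector R E & NormedModule_isEuclidean R E}.

Section Definitions.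
Context {R : realType} {E : euclideanType R}.
Implicit Types (X K A : set E) (f : E -> R) (x v w : E).

Definition tangent_cone X x : set E :=
  [set v | exists (z : nat -> E) (tau : nat -> R),
    [/\ forall k, X (z k),
        forall k, 0 < tau k,
        tau @ \oo --> (0 : R) &
        (fun k => (tau k)^-1 *: (z k - x)) @ \oo --> v]].

Definition polar K : set E := [set w | forall v, K v -> dotp w v <= 0].

Definition outer_limit (C : nat -> set E) : set E :=
  [set v | limn_einf (fun k => edist_inf (C k) v) = 0%E].

Definition convex_hull A : set E :=
  smallest (@convex_set R (convex_lmodType E)) A.

(* The set of all closest points: not a singleton in general, since K need not
   be convex. When K is a closed cone these points exist and share one norm. *)
Definition Proj K v : set E :=
  [set p | K p /\ forall w, K w -> `|v - p| <= `|v - w|].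

(* The Riesz representative of the differential (0 if there is none, which does
   not happen in finite dimension where f is differentiable). *)
Definition grad f x : E := xget 0 [set g | forall v, 'd f x v = dotp g v].

(* A function defined on a neighborhood of X is represented by a total function
   whose values outside that neighborhood are irrelevant. *)
Definition C1_near X f : Prop :=
  exists U : set E,
    [/\ open U, X `<=` U, forall y, U y -> differentiable f y &
        forall y, U y -> {for y, continuous (grad f)}].

Definition stationary X f x : Prop :=
  forall v, tangent_cone X x v -> 0 <= 'd f x v.

Definition eps_stationary X f (eps : R) x : Prop :=
  exists2 p, Proj (tangent_cone X x) (- grad f x) p & `|p| <= eps.

Definition apocalypse X x (xk : nat -> E) f : Prop :=
  [/\ X x,
      (forall k, X (xk k)) /\ xk @ \oo --> x,
      C1_near X f,
      (exists eps : nat -> R,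
        [/\ forall k, 0 < eps k,
            eps @ \oo --> (0 : R) &
            forall k, eps_stationary X f (eps k) (xk k)]) &
      ~ stationary X f x].

Definition apocalyptic X x : Prop :=
  exists (xk : nat -> E) f, apocalypse X x xk f.

End Definitions.

(* Main.v *)
(* For a point [p] of a cone [K] closest to [w], [<w, p> = |p|^2] and
   [<w, v> <= |p| |v|] on [K].  If the projections of the negative gradients on
   the tangent cones at [x_k] vanish in the limit, these inequalities pass to
   the limit along any sequence of tangent vectors defining an element of the
   outer limit, so [- grad f x] lies in its polar.  Conversely, if the norms of
   the projections [p_k] did not tend to 0, compactness would give a nonzero
   limit point [p] of the [p_k], lying in the outer limit, with
   [<- grad f x, p> = |p|^2 > 0].  An element of one polar outside the other is
   realized as a negative gradient by a linear function, and the convex hull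
   formulation is the bipolar theorem. *)

Require Import Defs.
From mathcomp Require Import all_boot all_order all_algebra.
From mathcomp Require Import all_classical all_reals all_analysis.
From mathcomp Require Import ring lra.
Import Order.TTheory GRing.Theory Num.Theory.
Import numFieldNormedType.Exports VectorInternalTheory.

Set Implicit Arguments.
Unset Strict Implicit.
Unset Printing Implicit Defensive.

Local Open Scope classical_set_scope.
Local Open Scope ring_scope.

(** * Inner product algebra and continuity *)

Section DotProduct.
Context {R : realType} {E : euclideanType R}.
Implicit Types (u v w : E) (a : R).

Lemma dotC u v : dotp u v = dotp v u.
Proof. by rewrite hermC/= expr0 mul1r. Qed.

Lemma dotDr u v w : dotp u (v + w) = dotp u v + dotp u w.
Proof. exact: linearDr. Qed.

Lemma dotZr a u v : dotp u (a *: v) = a * dotp u v.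
Proof. by rewrite linearZr. Qed.

Lemma dotDl u v w : dotp (u + v) w = dotp u w + dotp v w.
Proof. by rewrite dotC dotDr !(dotC w). Qed.

Lemma dotZl a u v : dotp (a *: u) v = a * dotp u v.
Proof. by rewrite dotC dotZr dotC. Qed.

Lemma dotNl u v : dotp (- u) v = - dotp u v.
Proof. by rewrite -scaleN1r dotZl mulN1r. Qed.

Lemma dotNr u v : dotp u (- v) = - dotp u v.
Proof. by rewrite -scaleN1r dotZr mulN1r. Qed.

Lemma dot0r u : dotp u 0 = 0.
Proof. by rewrite -(scale0r 0) dotZr mul0r. Qed.

Definition dotE := (dotDl, dotDr, dotNl, dotNr, dotZl, dotZr).

Lemma sqr_normB u v : `|u - v| ^+ 2 = `|u| ^+ 2 - 2 * dotp u v + `|v| ^+ 2.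
Proof. by rewrite !norm_dotp !dotE (dotC v u); ring. Qed.

Lemma ler_normB_sqr u v w :
  `|u - v| <= `|u - w| ->
  `|v| ^+ 2 - 2 * dotp u v <= `|w| ^+ 2 - 2 * dotp u w.
Proof.
rewrite -(@ler_pXn2r _ 2)// ?nnegrE// !sqr_normB; lra.
Qed.

(** Reduces continuity of the inner product to that of the norm. *)
Lemma dot_polarization u v :
  dotp u v = 4^-1 * (`|u + v| ^+ 2 - `|u - v| ^+ 2).
Proof. by rewrite !norm_dotp !dotE (dotC v u); field. Qed.

Lemma cvg_dot T (F : set_system T) (FF : Filter F) (f g : T -> E) u v :
  f @ F --> u -> g @ F --> v -> (fun x => dotp (f x) (g x)) @ F --> dotp u v.
Proof.
move=> fu gv; rewrite dot_polarization.
under eq_fun do rewrite dot_polarization.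
apply: cvgM; first exact: cvg_cst.
apply: cvgB; rewrite expr2; under eq_fun do rewrite expr2.
- by apply: cvgM; apply: cvg_norm; apply: cvgD.
- by apply: cvgM; apply: cvg_norm; apply: cvgB.
Qed.

End DotProduct.

(** * Compactness, closest points and Riesz representation in finite dimension *)

Section FiniteDimension.
Context {R : realType} {E : euclideanType R}.

Lemma continuous_r2v : continuous (@r2v R E).
Proof.
move=> c; suff: (fun d : 'rV[R]_(dim E) =>
    \sum_i (d 0 i *: r2v (delta_mx 0 i) : E)) @ c -->
    (\sum_i (c 0 i *: r2v (delta_mx 0 i) : E)).
  have r2vE d : r2v d = \sum_i (d 0 i *: r2v (delta_mx 0 i) : E).
    rewrite {1}(row_sum_delta d) linear_sum.
    by apply: eq_bigr => i _; rewrite linearZ.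
  by rewrite -r2vE; have <- : r2v = _ := funext r2vE.
have FF := nbhs_filter c; apply: cvg_big => [|i _].
  exact: add_continuous.
by apply: cvgZr_tmp; exact: coord_continuous.
Qed.

(** Bounded closed sets of row vectors are compact, and the ball is a closed subset of the image of
    one of them under the continuous map [r2v]. *)
Lemma closed_ball_compact (r : R) : compact [set v : E | `|v| <= r].
Proof.
pose S := [set c : 'rV[R]_(dim E) | `|c| = 1].
have normr_continuous : continuous (fun c : 'rV[R]_(dim E) => `|r2v c : E|).
  by move=> c; exact: (continuous_comp (@continuous_r2v c) (@norm_continuous _ E _)).
(* Equivalence of norms: [|r2v c|] is bounded below on the unit sphere. *)
have [m m0 Hm] : exists2 m : R, 0 < m &
    forall c : 'rV[R]_(dim E), m * `|c| <= `|r2v c : E|.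
  (* If the sphere is empty, 0 is the only row vector and any constant works. *)
  have [S0|S0] := pselect (S !=set0); last first.
    exists 1 => // c; have [->|c0] := eqVneq c 0.
      by rewrite normr0 mulr0.
    case: S0; exists (`|c|^-1 *: c); rewrite /S/= normrZ normfV normr_id.
    by rewrite mulVf// normr_eq0.
  have cS : compact S.
    apply: bounded_closed_compact.
      by exists 1; split => // x x1 c /= ->; exact: ltW.
    have -> : S = Num.norm @^-1` [set 1] by [].
    by apply: closed_comp => [c _|]; [exact: norm_continuous|exact: closed_eq].
  have [c] := compact_EVT_min S0 cS (continuous_subspaceT normr_continuous).
  rewrite inE => Sc minc.
  have c0 : c != 0 by rewrite -normr_eq0 Sc oner_neq0.
  exists `|r2v c : E|.
    rewrite normr_gt0; apply: contra c0 => /eqP r2vc0.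
    by apply/eqP/(@r2v_inj _ E); rewrite r2vc0 linear0.
  move=> d; have [->|d0] := eqVneq d 0; first by rewrite normr0 mulr0.
  have nd0 : 0 < `|d| by rewrite normr_gt0.
  rewrite -ler_pdivlMr// mulrC.
  have := minc (`|d|^-1 *: d); rewrite linearZ normrZ normfV normr_id; apply.
  by rewrite inE /S/= normrZ normfV normr_id mulVf// gt_eqF.
apply: (@subclosed_compact _ _ (r2v @` [set c : 'rV[R]_(dim E) | `|c| <= r / m])).
- have -> : [set v : E | `|v| <= r] = Num.norm @^-1` [set t | t <= r] by [].
  by apply: closed_comp => [c _|]; [exact: norm_continuous|exact: closed_le].
- apply: continuous_compact.
    exact: continuous_subspaceT continuous_r2v.
  apply: bounded_closed_compact.
    exists (r / m); split => [|x x1 c /= cr]; first exact: num_real.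
    exact: le_trans cr (ltW x1).
  have -> : [set c : 'rV[R]_(dim E) | `|c| <= r / m] =
    Num.norm @^-1` [set t | t <= r / m] by [].
  by apply: closed_comp => [c _|]; [exact: norm_continuous|exact: closed_le].
- move=> v /= vr; exists (v2r v); last exact: v2rK.
  by rewrite /= ler_pdivlMr// mulrC (le_trans (Hm _))// v2rK.
Qed.

(** Only points of [A] no farther from [v] than a chosen [a] compete; they form a compact set, on
    which the distance attains its minimum. *)
Lemma Proj_nonempty (A : set E) (v : E) :
  closed A -> A !=set0 -> Proj A v !=set0.
Proof.
move=> cA [a Aa].
pose B := A `&` [set w | `|v - w| <= `|v - a|].
have cB : compact B.
  apply: (@subclosed_compact _ _ [set w : E | `|w| <= `|v| + `|v - a|]).
  - apply: closedI => //.
    have -> : [set w | `|v - w| <= `|v - a|] =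
      (fun w => `|v - w|) @^-1` [set t | t <= `|v - a|] by [].
    apply: closed_comp => [w _|]; last exact: closed_le.
    by apply: cvg_norm; apply: cvgB; [exact: cvg_cst|exact: cvg_id].
  - exact: closed_ball_compact.
  - move=> w [_ /= wa]; rewrite -[w](subKr v) (le_trans (ler_normB _ _))//.
    by rewrite lerD2l.
have B0 : B !=set0 by exists a; split => /=.
have cf : {within B, continuous (fun w => `|v - w|)}.
  apply: continuous_subspaceT => w.
  by apply: cvg_norm; apply: cvgB; [exact: cvg_cst|exact: cvg_id].
have [p] := compact_EVT_min B0 cB cf.
rewrite inE => -[Ap pa] minp; exists p; split=> // w Aw.
have [wa|/ltW aw] := leP `|v - w| `|v - a|; last exact: le_trans aw.
by apply: minp; rewrite inE.
Qed.

(** The indices [s] need not increase: [i <= s i] already makes them tend to infinity. *)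
Lemma bounded_seq_subcvg (u : nat -> E) (r : R) :
  (forall k, `|u k| <= r) ->
  exists (s : nat -> nat) (p : E),
    (forall i, (i <= s i)%N) /\ (u \o s) @ \oo --> p.
Proof.
move=> ur; have [|p [_ clp]] := @closed_ball_compact r (u @ \oo) _.
  by exists 0%N => // k _; exact: ur.
have /choice[s Hs] i : exists k, (i <= k)%N /\ `|p - u k| < i.+1%:R^-1.
  have i0 : 0 < i.+1%:R^-1 :> R by rewrite invr_gt0.
  have [|y [[k /= ik <-] pk]] := clp (u @` [set k | (i <= k)%N])
      (ball p i.+1%:R^-1) _ (nbhsx_ballx _ _ i0).
  - by exists i => //= k ik; exists k.
  - by exists k; split => //; move: pk; rewrite -ball_normE.
exists s, p; split=> [i|]; first by have [] := Hs i.
apply/cvgrPdist_lt => e e0; near=> i.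
have [_ /lt_trans] := Hs i; apply.
by near: i; exact: near_infty_natSinv_lt (PosNum e0).
Unshelve. all: by end_near. Qed.

(* The representative is a multiple of the point of the hyperplane [L = 1]
   closest to the origin. *)
Lemma riesz_representation (L : {linear E -> R^o}) :
  continuous L -> exists g, forall v, L v = dotp g v.
Proof.
move=> cL; have [[w Lw]|L0] := pselect (exists w, L w != 0); last first.
  exists 0 => v; rewrite dotC dot0r; apply: contra_notP L0 => /eqP.
  by exists v.
have cA : closed (L @^-1` [set 1 : R^o]).
  by apply: closed_comp => [v _|]; [exact: cL|exact: closed_eq].
have [|p [/= Lp minp]] := @Proj_nonempty _ 0 cA.
  by exists ((L w)^-1 *: w); rewrite /= linearZ/= [_ *: _]mulVf.
have p0 : 0 < `|p| ^+ 2.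
  rewrite exprn_gt0// normr_gt0; apply/eqP => p0; move: Lp.
  by rewrite p0 linear0 => /eqP; rewrite eq_sym oner_eq0.
have orth v : L v = 0 -> dotp p v = 0.
  move=> Lv; have [->|v0] := eqVneq v 0; first exact: dot0r.
  have vv : 0 < `|v| ^+ 2 by rewrite exprn_gt0// normr_gt0.
  (* This [t] minimizes the norm of [p + t *: v], which stays on the hyperplane [L = 1]. *)
  pose t := - dotp p v / `|v| ^+ 2.
  have /ler_normB_sqr : `|0 - p| <= `|0 - (p + t *: v)|.
    by apply: minp; rewrite /= linearD linearZ/= Lv Lp scaler0 addr0.
  rewrite ![dotp 0 _]dotC !dot0r !mulr0 !subr0 [`|p + _| ^+ 2]norm_dotp !dotE.
  rewrite -!norm_dotp (dotC v p) => h.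
  have : 0 <= t * (2 * dotp p v + t * `|v| ^+ 2) by lra.
  rewrite /t divfK ?gt_eqF// => {}h.
  have : 0 <= - (dotp p v ^+ 2 / `|v| ^+ 2) by move: h; congr (_ <= _); ring.
  rewrite oppr_ge0 pmulr_lle0 ?invr_gt0// => h2.
  by apply/eqP; rewrite -sqrf_eq0 eq_le h2 sqr_ge0.
(* The vector [v - L v *: p] lies in the kernel of [L], hence is orthogonal to [p]. *)
exists ((`|p| ^+ 2)^-1 *: p) => v.
have := orth (v - L v *: p); rewrite linearB linearZ/= Lp [_ *: 1]mulr1 subrr.
move=> /(_ erefl)/eqP; rewrite !dotE -norm_dotp subr_eq0 => /eqP->.
by rewrite mulrCA mulVf ?gt_eqF// mulr1.
Qed.

End FiniteDimension.

(** Let [t] tend to 0. This extracts first-order conditions from quadratic inequalities divided by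
    [t]. *)
Lemma le0_of_le_mul_small (R : realFieldType) (a b : R) :
  (forall t, 0 < t < 1 -> a <= t * b) -> a <= 0.
Proof.
move=> H; rewrite leNgt; apply/negP => a0.
have d0 : 0 < 2 * a + `|b| by have := normr_ge0 b; lra.
have /H : 0 < a / (2 * a + `|b|) < 1.
  by rewrite divr_gt0//= ltr_pdivrMr// mul1r; have := normr_ge0 b; lra.
rewrite mulrAC ler_pdivlMr// ler_pM2l// => h.
by have := ler_norm b; lra.
Qed.

Lemma closure_sub_closed (T : topologicalType) (A B : set T) :
  closed B -> A `<=` B -> closure A `<=` B.
Proof. by move=> /closure_id {2}-> /closure_subset. Qed.

(** * Projections on cones, closed convex hulls and polars *)

Section Cones.
Context {R : realType} {E : euclideanType R}.
Implicit Types (K : set E) (u v w p : E).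

Definition cone K := forall (s : R) v, 0 < s -> K v -> K (s *: v).

Lemma Proj_ge K w p v : Proj K w p -> K v ->
  `|p| ^+ 2 - 2 * dotp w p <= `|v| ^+ 2 - 2 * dotp w v.
Proof. by move=> [_ minp] /minp; exact: ler_normB_sqr. Qed.

(** Along the ray of [p] the squared distance to [w] is a quadratic in the factor [s], minimal at
    [s = 1]; its derivative vanishes there. The factors [1 + t] and [1 - t] give the two
    inequalities. *)
Lemma dot_Proj_cone K w p : cone K -> Proj K w p -> dotp w p = `|p| ^+ 2.
Proof.
move=> coneK prp; have Kp := proj1 prp.
have scaled s : 0 < s ->
    `|p| ^+ 2 - 2 * dotp w p <= s ^+ 2 * `|p| ^+ 2 - 2 * s * dotp w p.
  move=> s0; have := Proj_ge prp (coneK _ _ s0 Kp).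
  by rewrite normrZ gtr0_norm// dotZr exprMn; lra.
apply/eqP; rewrite eq_le; apply/andP; split.
- suff : 2 * (dotp w p - `|p| ^+ 2) <= 0 by lra.
  apply: (@le0_of_le_mul_small _ _ (`|p| ^+ 2)) => t /andP[t0 t1].
  have := scaled (1 + t); rewrite addr_gt0// => /(_ isT) h.
  by rewrite -(ler_pM2l t0); lra.
- suff : 2 * (`|p| ^+ 2 - dotp w p) <= 0 by lra.
  apply: (@le0_of_le_mul_small _ _ (`|p| ^+ 2)) => t /andP[t0 t1].
  have := scaled (1 - t); rewrite subr_gt0 t1 => /(_ isT) h.
  by rewrite -(ler_pM2l t0); lra.
Qed.

Lemma dot_le_Proj_cone K w p v :
  cone K -> Proj K w p -> K v -> dotp w v <= `|p| * `|v|.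
Proof.
move=> coneK prp Kv.
have scaled s : 0 < s ->
    - `|p| ^+ 2 <= s ^+ 2 * `|v| ^+ 2 - 2 * s * dotp w v.
  move=> s0; have := Proj_ge prp (coneK _ _ s0 Kv).
  rewrite normrZ gtr0_norm// dotZr exprMn mulrA (dot_Proj_cone coneK prp).
  lra.
have [->|v0] := eqVneq v 0; first by rewrite dot0r normr0 mulr0.
have {}v0 : 0 < `|v| by rewrite normr_gt0.
(* The optimal factor below would be 0 here, which is not allowed; small positive factors replace
   it. *)
have [p0|p0] := eqVneq p 0.
  rewrite p0 normr0 mul0r; suff : 2 * dotp w v <= 0 by lra.
  apply: (@le0_of_le_mul_small _ _ (`|v| ^+ 2)) => t /andP[t0 _].
  have := scaled t t0; rewrite p0 normr0 expr0n/= oppr0 => h.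
  by rewrite -(ler_pM2l t0); lra.
have {}p0 : 0 < `|p| by rewrite normr_gt0.
(* This factor gives [s *: v] the norm of [p], which yields the sharpest bound from [scaled]. *)
have s0 : 0 < `|p| / `|v| by rewrite divr_gt0.
have := scaled _ s0; rewrite -exprMn divfK ?gt_eqF// => h.
rewrite -(ler_pM2l s0).
by rewrite (_ : _ * (_ * _) = `|p| ^+ 2); [lra|field; rewrite gt_eqF].
Qed.

Lemma norm_Proj_cone K w p : cone K -> Proj K w p -> `|p| <= `|w|.
Proof.
move=> coneK prp; rewrite -(@ler_pXn2r _ 2)// ?nnegrE//.
have := sqr_ge0 `|w - p|; rewrite sqr_normB (dot_Proj_cone coneK prp); lra.
Qed.

(** For fixed [u], the points [v] that satisfy the conclusion form a closed set containing the hull.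
    One endpoint in [A] is enough for the separation argument. *)
Lemma closure_convex_hull_segment (A : set E) u v (t : R) :
  0 < t < 1 -> A u -> closure (convex_hull A) v ->
  closure (convex_hull A) (t *: u + (1 - t) *: v).
Proof.
move=> /andP[t0 t1] Au.
have clo : closed ((fun w => t *: u + (1 - t) *: w) @^-1`
    closure (convex_hull A)).
  apply: closed_comp => [w _|]; last exact: closed_closure.
  by apply: cvgD; [exact: cvg_cst|apply: cvgZl_tmp; exact: cvg_id].
move: v; apply: (closure_sub_closed clo) => w hw /=; apply: subset_closure => B [cB AB].
have := cB u w (Itv01 (ltW t0) (ltW t1)).
rewrite !inE; apply; first exact: AB.
exact: hw.
Qed.

(** The half-space [dotp w v <= 0] is closed and convex. *)
Lemma polar_closure_convex_hull (A : set E) :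
  polar A `<=` polar (closure (convex_hull A)).
Proof.
move=> w wA v.
have clo : closed (dotp w @^-1` [set t | t <= 0]).
  apply: closed_comp => [u _|]; last exact: closed_le.
  by apply: cvg_dot; [exact: cvg_cst|exact: cvg_id].
move: v; rewrite -[forall v, _]/(_ `<=` dotp w @^-1` [set t | t <= 0]).
apply: (closure_sub_closed clo); apply: smallest_sub => // x y l.
rewrite !inE => /= x0 y0.
change (dotp w (l%:num *: (x : E) + (1 - l%:num) *: (y : E)) <= 0).
have l0 : 0 <= l%:num by [].
have l1 : 0 <= 1 - l%:num by rewrite subr_ge0.
rewrite dotDr !dotZr; nra.
Qed.

End Cones.

(** * Sequential description of the outer limit *)

Section OuterLimit.
Context {R : realType} {E : euclideanType R}.

Lemma cvg_of_dist_lt_natSinv (u : nat -> E) (v : E) :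
  (forall i, `|v - u i| < i.+1%:R^-1) -> u @ \oo --> v.
Proof.
move=> H; apply/cvgrPdist_lt => e e0; near=> i.
apply: lt_trans (H i) _.
by near: i; exact: near_infty_natSinv_lt (PosNum e0).
Unshelve. all: by end_near. Qed.

Lemma cvg_infty_of_le (s : nat -> nat) :
  (forall i, (i <= s i)%N) -> s @ \oo --> \oo.
Proof.
move=> Hs A [N _ NA]; exists N => // i /= Ni; apply: NA => /=.
exact: leq_trans Ni (Hs i).
Qed.

(** The limit inferior is the supremum of the tail infima of the distances. If it is 0, every tail
    contains a set with a point as close to [v] as desired. *)
Lemma outer_limitP (C : nat -> set E) (v : E) :
  outer_limit C v <->
  exists (s : nat -> nat) (w : nat -> E),
    [/\ forall i, (i <= s i)%N, forall i, C (s i) (w i) & w @ \oo --> v].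
Proof.
rewrite /outer_limit /= limn_einf_lim (cvg_lim _ (@cvg_einfs_sup _ _))//.
set u := fun k => edist_inf (C k) v; split=> [sup0|[s [w [is_ Cw wv]]]].
- have H i : exists kw : nat * E,
      [/\ (i <= kw.1)%N, C kw.1 kw.2 & `|v - kw.2| < i.+1%:R^-1].
    have i0 : (0 < (i.+1%:R^-1)%:E :> \bar R)%E by rewrite lte_fin invr_gt0.
    have /le_lt_trans/(_ i0) : (einfs u i <= 0)%E.
      by rewrite -sup0; apply: ereal_sup_ubound; exists i.
    case/ereal_inf_lt => _ [k /= ik <-] /ereal_inf_lt[_ [w Cw <-]].
    move=> /edist_lt_ball/=; rewrite -ball_normE => vw.
    by exists (k, w).
  have [f Hf] := choice H.
  exists (fun i => (f i).1), (fun i => (f i).2); split.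
  + by move=> i; have [] := Hf i.
  + by move=> i; have [] := Hf i.
  + by apply: cvg_of_dist_lt_natSinv => i; have [] := Hf i.
- apply/eqP; rewrite eq_le; apply/andP; split.
  + apply: ge_ereal_sup => _ [n _ <-]; apply/lee_addgt0Pr => e e0.
    rewrite add0e; have /cvgrPdist_lt/(_ _ e0)[N _ HN] := wv.
    (* The index is at least [n], to lie in the tail, and at least [N], to be close to [v]. *)
    have {}HN := HN (maxn n N) (leq_maxr _ _).
    apply: le_trans (_ : u (s (maxn n N)) <= _)%E.
      apply: ereal_inf_lbound; exists (s (maxn n N)) => //=.
      exact: leq_trans (leq_maxl _ _) (is_ _).
    apply: le_trans (_ : edist (v, w (maxn n N)) <= _)%E.
      by apply: ereal_inf_lbound; exists (w (maxn n N)).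
    by apply: edist_fin => //=; rewrite -ball_normE.
  + apply: le_trans (_ : einfs u 0%N <= _)%E.
      by apply: le_ereal_inf_tmp => _ [k _ <-]; exact: edist_inf_ge0.
    by apply: ereal_sup_ubound; exists 0%N.
Qed.

Lemma cone_outer_limit (C : nat -> set E) :
  (forall k, cone (C k)) -> cone (outer_limit C).
Proof.
move=> coneC a v a0 /outer_limitP[s [w [is_ Cw wv]]]; apply/outer_limitP.
exists s, (fun i => a *: w i); split=> // [i|]; first exact: coneC.
exact: cvgZl_tmp.
Qed.

Lemma outer_limit0 (C : nat -> set E) :
  (forall k, C k 0) -> outer_limit C 0.
Proof.
move=> C0; apply/outer_limitP; exists id, (fun=> 0); split=> //.
exact: cvg_cst.
Qed.

End OuterLimit.

(** * Tangent cones are closed cones *)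

Section TangentCone.
Context {R : realType} {E : euclideanType R}.

(** Trades sequences for approximation at each scale [e], so that closedness needs no diagonal
    extraction. *)
Lemma tangent_coneP (X : set E) (x v : E) :
  tangent_cone X x v <->
  forall e : R, 0 < e -> exists (z : E) (t : R),
    [/\ X z, 0 < t < e & `|v - t^-1 *: (z - x)| < e].
Proof.
split=> [[z [tau [Xz tau0 tauto ztov]]] e e0|H].
- near \oo => k; exists (z k), (tau k); split => //.
    rewrite tau0/= -[tau k]ger0_norm ?ltW// -normrN -sub0r.
    by near: k; move/cvgrPdist_lt : tauto; exact.
  by near: k; move/cvgrPdist_lt : ztov; exact.
- have H' i : exists zt : E * R, [/\ X zt.1, 0 < zt.2 < i.+1%:R^-1 &
      `|v - zt.2^-1 *: (zt.1 - x)| < i.+1%:R^-1].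
    by have [|z [t zt]] := H i.+1%:R^-1; [rewrite invr_gt0|exists (z, t)].
  have [f Hf] := choice H'; exists (fst \o f), (snd \o f); split.
  + by move=> k; have [] := Hf k.
  + by move=> k; have [_ /andP[]] := Hf k.
  + apply/cvgrPdist_lt => e e0; near=> i.
    have [_ /andP[t0 ti] _] := Hf i.
    rewrite sub0r normrN gtr0_norm//; apply: lt_trans ti _.
    by near: i; exact: near_infty_natSinv_lt (PosNum e0).
  + by apply: cvg_of_dist_lt_natSinv => k; have [] := Hf k.
Unshelve. all: by end_near. Qed.

Lemma closed_tangent_cone (X : set E) (x : E) : closed (tangent_cone X x).
Proof.
move=> v clv; apply/tangent_coneP => e e0.
have e20 : 0 < e / 2 by rewrite divr_gt0.
have [u [/tangent_coneP/(_ _ e20)[z [t [Xz /andP[t0 te] ut]]] vu]] :=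
  clv _ (nbhsx_ballx v _ e20).
have e2e : e / 2 < e by lra.
exists z, t; split => //; first by rewrite t0 (lt_trans te).
rewrite (splitr e) -(subrKA u) (le_lt_trans (ler_normD _ _))// ltrD//.
by move: vu; rewrite -ball_normE.
Qed.

Lemma cone_tangent_cone (X : set E) (x : E) : cone (tangent_cone X x).
Proof.
move=> a v a0 /tangent_coneP H; apply/tangent_coneP => e e0.
(* Scaling by [a] divides the step [t] by [a] and multiplies the error by [a]; each bound handles
   one of them. *)
have d0 : 0 < Num.min (e * a) (e / a).
  by rewrite lt_min mulr_gt0// divr_gt0.
have [z [t [Xz]]] := H _ d0; rewrite !lt_min => /and3P[t0 tea _] /andP[_ vt].
exists z, (t / a); split => //.
  by rewrite divr_gt0//= ltr_pdivrMr.
rewrite invf_div -scalerA -scalerBr normrZ gtr0_norm//.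
by rewrite mulrC -ltr_pdivlMr.
Qed.

Lemma tangent_cone0 (X : set E) (x : E) : X x -> tangent_cone X x 0.
Proof.
move=> Xx; apply/tangent_coneP => e e0; exists x, (e / 2); split => //.
  by apply/andP; split; lra.
by rewrite subrr scaler0 subrr normr0.
Qed.

End TangentCone.

(* Bipolar theorem: a point [v] of [K] outside the closed convex hull of the
   cone [L] is separated from it by [v - p], where [p] is the projection of
   [v]. *)
Lemma polar_sub_polarP (R : realType) (E : euclideanType R) (L K : set E) : cone L -> L 0 ->
  polar L `<=` polar K <-> K `<=` closure (convex_hull L).
Proof.
move=> coneL L0; split=> [LK v Kv|KL w /polar_closure_convex_hull wL v /KL]; last exact: wL.
set C := closure (convex_hull L).
have LC : L `<=` C by move=> u Lu; apply: subset_closure; exact: sub_gen_smallest.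
have [//|nCv] := pselect (C v); exfalso.
have [|p prp] := @Proj_nonempty _ _ C v (@closed_closure _ _).
  by exists 0; exact: LC.
have Cp := proj1 prp.
(* First-order condition for moving from [p] towards [u] inside the convex set [C]. *)
have obtuse u : L u -> dotp (v - p) (u - p) <= 0.
  move=> Lu; suff : 2 * dotp (v - p) (u - p) <= 0 by lra.
  apply: (@le0_of_le_mul_small _ _ (`|u - p| ^+ 2)) => t /andP[t0 t1].
  have tin : 0 < t < 1 by rewrite t0.
  have := proj2 prp _ (closure_convex_hull_segment tin Lu Cp).
  have -> : t *: u + (1 - t) *: p = p + t *: (u - p).
    by rewrite scalerBr scalerBl scale1r addrCA addrA.
  rewrite opprD addrA -(@ler_pXn2r _ 2)// ?nnegrE// (sqr_normB (v - p)) dotZr.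
  rewrite normrZ gtr0_norm// exprMn => h.
  by rewrite -(ler_pM2l t0); lra.
have Lle u : L u -> dotp (v - p) u <= dotp (v - p) p.
  by move=> /obtuse; rewrite dotDr dotNr; lra.
have p0 : 0 <= dotp (v - p) p by rewrite -(dot0r (v - p)) Lle.
have polarL : polar L (v - p).
  (* Apply [Lle] to [t^-1 *: u], with [t] small: a linear form bounded above on a cone is
     nonpositive there. *)
  move=> u Lu; apply: (@le0_of_le_mul_small _ _ (dotp (v - p) p)) => t.
  move=> /andP[t0 _]; have : 0 < t^-1 by rewrite invr_gt0.
  move=> /(coneL t^-1)/(_ Lu)/Lle; rewrite dotZr.
  by rewrite mulrC ler_pdivrMr// mulrC.
(* The product of [v - p] with [v] is nonpositive while that with [p] is nonnegative, which forces
   [v = p]. *)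
have := LK _ polarL v Kv; rewrite -{2}(subrK p v) dotDr -norm_dotp => h.
have : `|v - p| ^+ 2 <= 0 by lra.
rewrite exprn_even_le0//= normr_eq0 subr_eq0 => /eqP vp.
by apply: nCv; rewrite vp.
Qed.

(** * Apocalypses and apocalyptic points through polars *)

Section Apocalypses.
Context {R : realType} {E : euclideanType R}.
Implicit Types (X : set E) (f : E -> R) (x v w : E).

Lemma diffE f x v : differentiable f x -> 'd f x v = dotp (grad f x) v.
Proof.
move=> df; apply: (@xgetPex _ 0 [set g | forall u, 'd f x u = dotp g u]).
exact: riesz_representation (diff_continuous df).
Qed.

Lemma stationaryP X f x : differentiable f x ->
  stationary X f x <-> polar (tangent_cone X x) (- grad f x).
Proof.
by move=> df; split=> H v /H; rewrite diffE// dotNl oppr_le0.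
Qed.

Lemma apocalypse_polar X x (xk : nat -> E) f :
  apocalypse X x xk f ->
  polar (outer_limit (fun k => tangent_cone X (xk k))) (- grad f x).
Proof.
move=> [Xx [Xxk xkx] [U [_ XU _ cU]] [eps [_ eps0 st]] _].
move=> v /outer_limitP[s [w [is_ Tw wv]]].
have gs : (fun i => - grad f (xk (s i))) @ \oo --> - grad f x.
  apply: cvgN; apply: continuous_cvg; first exact: cU (XU _ Xx).
  exact: cvg_comp (cvg_infty_of_le is_) xkx.
(* The upper bound is [eps (s i)] times the norm of [w i]: the first factor tends to 0, the second
   converges. *)
have := ler_cvg_to (cvg_dot _ gs wv)
  (cvgM (cvg_comp _ _ (cvg_infty_of_le is_) eps0) (cvg_norm wv)).
rewrite mul0r; apply; apply: nearW => i /=.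
have [p prp pe] := st (s i).
apply: le_trans (dot_le_Proj_cone (@cone_tangent_cone _ _ X _) prp (Tw i)) _.
exact: ler_wpM2r.
Qed.

Lemma norm_Proj_cvg0 (C : nat -> set E) (w p : nat -> E) (l : E) :
  (forall k, cone (C k)) -> w @ \oo --> l ->
  (forall k, Proj (C k) (w k) (p k)) -> polar (outer_limit C) l ->
  (fun k => `|p k|) @ \oo --> (0 : R).
Proof.
move=> coneC wl prp lC; apply: contrapT => np0.
have [d d0 Hd] : exists2 d : R, 0 < d &
    forall i, exists k, (i <= k)%N /\ d <= `|p k|.
  apply: contrapT => H; apply: np0; apply/cvgrPdist_lt => e e0.
  apply: contrapT => N; apply: H; exists e => // i.
  apply: contrapT => M; apply: N; exists i => // k /= ik.
  rewrite sub0r normrN normr_id ltNge; apply/negP => ek.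
  by apply: M; exists k.
have [s Hs] := choice Hd.
have [M wM] : exists M : R, forall k, `|p (s k)| <= M.
  have [M [_ HM]] := cvg_seq_bounded (cvgP _ wl).
  exists (M + 1) => k; apply: le_trans (norm_Proj_cone (coneC _) (prp _)) _.
  by apply: (HM (M + 1)) => //; rewrite ltrDl.
have [t [q [it pq]]] := bounded_seq_subcvg wM.
have ist i : (i <= s (t i))%N by rewrite (leq_trans (it i))//; have [] := Hs (t i).
have Cq : outer_limit C q.
  by apply/outer_limitP; exists (s \o t), (p \o (s \o t)); split => // i;
    exact: (proj1 (prp _)).
have wst := cvg_comp _ _ (cvg_infty_of_le ist) wl.
(* The product of [w] and [p] is the squared norm of [p], at least [d ^+ 2] along the chosen
   indices; in the limit this contradicts polarity. *)
have : d ^+ 2 <= dotp l q.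
  apply: ler_cvg_to (cvg_cst _) (cvg_dot _ wst pq) _; apply: nearW => i /=.
  rewrite (dot_Proj_cone (coneC _) (prp _)) ler_pXn2r ?nnegrE ?(ltW d0)//.
  by have [] := Hs (t i).
rewrite leNgt => /negP; apply; apply: le_lt_trans (lC _ Cq) _.
by rewrite exprn_gt0.
Qed.

Lemma apocalypseP X x (xk : nat -> E) f :
  X x -> (forall k, X (xk k)) -> xk @ \oo --> x -> C1_near X f ->
  apocalypse X x xk f <->
  (polar (outer_limit (fun k => tangent_cone X (xk k)))
     `\` polar (tangent_cone X x)) (- grad f x).
Proof.
move=> Xx Xxk xkx C1f; have [U [_ XU dU cU]] := C1f.
have dfx := dU _ (XU _ Xx); split=> [apo|[polL npolT]].
  split; first exact: apocalypse_polar apo.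
  by case: apo => _ _ _ _ nst /(stationaryP _ dfx).
split => //; last by move=> /(stationaryP _ dfx).
have Proj_ex k : Proj (tangent_cone X (xk k)) (- grad f (xk k)) !=set0.
  apply: Proj_nonempty; first exact: closed_tangent_cone.
  by exists 0; exact: tangent_cone0.
have [p prp] := choice Proj_ex.
have gx : (fun k => - grad f (xk k)) @ \oo --> - grad f x.
  by apply: cvgN; apply: continuous_cvg => //; exact: cU (XU _ Xx).
have p0 := norm_Proj_cvg0 (fun k => @cone_tangent_cone _ _ X (xk k)) gx prp polL.
(* The harmonic term keeps the tolerances strictly positive when [p k] is 0. *)
exists (fun k => `|p k| + k.+1%:R^-1); split.
- by move=> k; rewrite ltr_wpDl.
- by rewrite -(addr0 0); apply: cvgD => //; exact: cvg_harmonic.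
- by move=> k; exists (p k); rewrite // lerDl.
Qed.

Lemma dot_differentiable w x : differentiable (dotp w : E -> R) x.
Proof.
apply: (@linear_differentiable _ _ R^o (dotp w)) => v.
by apply: cvg_dot; [exact: cvg_cst|exact: cvg_id].
Qed.

Lemma grad_dot w x : grad (dotp w : E -> R) x = w.
Proof.
(* Pair the difference of the two vectors with itself: both represent the same differential. *)
apply/eqP; rewrite -subr_eq0 -normr_eq0 -sqrf_eq0 norm_dotp dotDl dotNl.
rewrite -diffE; last exact: dot_differentiable.
rewrite (@diff_lin _ _ R^o (dotp w)) ?subrr// => v.
by apply: cvg_dot; [exact: cvg_cst|exact: cvg_id].
Qed.

Lemma C1_near_dot X w : C1_near X (dotp w : E -> R).
Proof.
exists setT; split=> // [|y _|y _]; first exact: openT.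
  exact: dot_differentiable.
have -> : grad (dotp w : E -> R) = cst w by apply/funext => z; exact: grad_dot.
exact: cvg_cst.
Qed.

Lemma apocalypticP X x : X x ->
  apocalyptic X x <->
  exists xk : nat -> E,
    [/\ forall k, X (xk k), xk @ \oo --> x &
        ~ (polar (outer_limit (fun k => tangent_cone X (xk k)))
             `<=` polar (tangent_cone X x))].
Proof.
move=> Xx; split=> [[xk [f apo]]|[xk [Xxk xkx npol]]].
  have [_ [Xxk xkx] C1f _ _] := apo; exists xk; split=> // sub.
  by have [polL npolT] := proj1 (apocalypseP Xx Xxk xkx C1f) apo; exact/npolT/sub.
have [w [wL wT]] : (polar (outer_limit (fun k => tangent_cone X (xk k)))
    `\` polar (tangent_cone X x)) !=set0.
  by apply: contrapT => H; apply: npol => w wL; apply: contrapT => wT;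
    apply: H; exists w.
(* The sign makes the negative gradient equal to [w] everywhere. *)
exists xk, (dotp (- w)).
apply: (proj2 (apocalypseP Xx Xxk xkx (C1_near_dot X (- w)))).
by rewrite grad_dot opprK.
Qed.

End Apocalypses.

Theorem theorem2p13 (R : realType) (E : euclideanType R) (X : set E) :
  (forall (x : E) (xk : nat -> E) (f : E -> R),
     X x -> (forall k, X (xk k)) -> xk @ \oo --> x -> C1_near X f ->
     (apocalypse X x xk f <->
      (polar (outer_limit (fun k => tangent_cone X (xk k)))
         `\` polar (tangent_cone X x)) (- grad f x)))
  /\
  (forall x : E, X x ->
     [/\ apocalyptic X x <->
         (exists xk : nat -> E,
            [/\ forall k, X (xk k), xk @ \oo --> x &
                ~ (polar (outer_limit (fun k => tangent_cone X (xk k)))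
                     `<=` polar (tangent_cone X x))]),
         apocalyptic X x <->
         (exists xk : nat -> E,
            [/\ forall k, X (xk k), xk @ \oo --> x &
                ~ (tangent_cone X x `<=`
                   closure (convex_hull
                     (outer_limit (fun k => tangent_cone X (xk k)))))]) &
         forall xk : nat -> E, (forall k, X (xk k)) -> xk @ \oo --> x ->
           (~ (polar (outer_limit (fun k => tangent_cone X (xk k)))
                 `<=` polar (tangent_cone X x)) <->
            ~ (tangent_cone X x `<=`
               closure (convex_hull
                 (outer_limit (fun k => tangent_cone X (xk k))))))]).
Proof.
split=> [|x Xx]; first by move=> x xk f; exact: apocalypseP.
have bipolar (xk : nat -> E) : (forall k, X (xk k)) ->
    ~ (polar (outer_limit (fun k => tangent_cone X (xk k)))
         `<=` polar (tangent_cone X x)) <->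
    ~ (tangent_cone X x `<=`
       closure (convex_hull
         (outer_limit (fun k => tangent_cone X (xk k))))).
  (* The outer limit contains 0 because every [xk k] lies in [X]. *)
  move=> Xxk; have H := polar_sub_polarP (tangent_cone X x)
    (cone_outer_limit (fun k => @cone_tangent_cone _ _ X (xk k)))
    (outer_limit0 (fun k => tangent_cone0 (Xxk k))).
  by split=> N /H.
split; first exact: apocalypticP; last by move=> xk Xxk _; exact: bipolar.
apply: iff_trans (apocalypticP Xx) _; split=> -[xk [Xxk xkx /(bipolar xk Xxk) N]];
  by exists xk.
Qed.
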